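(* Almost surely, $S^X_N \to S^X$ as $N\to\infty$, and almost surely, $T^X_N \to S^X$ as $N\to\infty$.
   Context: Let $X\in\mathbb{R}^{p_1}$ and $Z\in\mathbb{R}^{p_2}$ be independent random vectors, $f$ a deterministic (measurable) real-valued function, $Z'$ an independent copy of $Z$, independent of $(X,Z)$, and $Y=f(X,Z)$, $Y^X=f(X,Z')$. Assume $Y$ is square integrable with $\mathrm{Var}(Y)\neq 0$. The Sobol index is $S^X=\mathrm{Var}(\mathbb{E}(Y|X))/\mathrm{Var}(Y)$. Let $(X_i,Z_i,Z_i')_{i\ge 1}$ be i.i.d. copies of $(X,Z,Z')$, and $Y_i=f(X_i,Z_i)$, $Y_i^X=f(X_i,Z_i')$. With all sums over $i=1,\dots,N$, define the estimators $$S^X_N = \frac{ \frac{1}{N} \sum Y_i Y_i^X - \left(\frac{1}{N} \sum Y_i\right) \left(\frac{1}{N}\sum Y_i^X\right) }{ \frac{1}{N}\sum Y_i^2 - \left( \frac{1}{N} \sum Y_i \right)^2 },\qquad T^X_N = \frac{ \frac{1}{N} \sum Y_i Y_i^X - \left(\frac{1}{N} \sum \frac{Y_i+Y_i^X}{2}\right)^2 }{ \frac{1}{N}\sum \frac{Y_i^2+(Y_i^X)^2}{2} - \left( \frac{1}{N} \sum \frac{Y_i+Y_i^X}{2} \right)^2 },$$ (with an arbitrary fixed value when a denominator vanishes). *)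

(* Defs.v *)
From HB Require Import structures.
From mathcomp Require Export all_boot all_order all_algebra finmap.
From mathcomp Require Export all_classical all_reals all_analysis.

Set Implicit Arguments.
Unset Strict Implicit.
Unset Printing Implicit Defensive.

Import Order.TTheory GRing.Theory Num.Theory.
Import numFieldNormedType.Exports.

Local Open Scope classical_set_scope.
Local Open Scope ring_scope.

(* Random vectors in R^p are random variables with values in [p.-tuple R],
   whose measurable structure is generated by the coordinates, i.e., the Borel
   sigma-algebra of R^p. *)

Definition same_law d d' (T : measurableType d) (T' : measurableType d')
    (R : realType) (P : probability T R) (U V : T -> T') : Prop :=
  forall A, measurable A -> P (U @^-1` A) = P (V @^-1` A).

Definition independent2 d d1 d2 (T : measurableType d)
    (T1 : measurableType d1) (T2 : measurableType d2)
    (R : realType) (P : probability T R) (U : T -> T1) (V : T -> T2) : Prop :=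
  forall A B, measurable A -> measurable B ->
    P (U @^-1` A `&` V @^-1` B) = (P (U @^-1` A) * P (V @^-1` B))%E.

Definition mutually_independent d d' (T : measurableType d)
    (T' : measurableType d') (R : realType) (P : probability T R)
    (U : nat -> T -> T') : Prop :=
  forall (J : {fset nat}) (A : nat -> set T'),
    (forall i, measurable (A i)) ->
    P (\bigcap_(i in [set` J]) (U i @^-1` A i)) =
      (\prod_(i <- J) P (U i @^-1` A i))%E.

Definition iid_copies d d' (T : measurableType d)
    (T' : measurableType d') (R : realType) (P : probability T R)
    (U : T -> T') (Us : nat -> T -> T') : Prop :=
  mutually_independent P Us /\ forall i, same_law P (Us i) U.

Definition is_cond_exp d d' (T : measurableType d) (T' : measurableType d')
    (R : realType) (P : probability T R) (X : T -> T') (Y W : T -> R) : Prop :=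
  [/\ forall B : set R, measurable B ->
        g_sigma_algebra_preimage X (W @^-1` B),
      P.-integrable setT (EFin \o W)
    & forall A : set T, g_sigma_algebra_preimage X A ->
        (\int[P]_(w in A) (W w)%:E = \int[P]_(w in A) (Y w)%:E)%E].

(* An arbitrary version of E(Y|X); versions exist when X is measurable and Y is
   integrable, and are almost surely equal. The default value [cst 0] is only
   used when there is no version. *)
Definition cond_exp d d' (T : measurableType d) (T' : measurableType d')
    (R : realType) (P : probability T R) (X : T -> T') (Y : T -> R) : T -> R :=
  xget (cst 0) [set W | is_cond_exp P X Y W].

Definition sobol_index d d' (T : measurableType d) (T' : measurableType d')
    (R : realType) (P : probability T R) (X : T -> T') (Y : T -> R) : R :=
  fine 'V_P[cond_exp P X Y] / fine 'V_P[Y].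

Definition emp_mean (R : realType) (N : nat) (u : nat -> R) : R :=
  N%:R^-1 * \sum_(i < N) u i.

Definition ratio_or (R : realType) (c num den : R) : R :=
  if den == 0 then c else num / den.

(* Samples are indexed from 0: [y i] and [y' i] are Y_(i+1) and Y^X_(i+1). *)
Definition sobol_S (R : realType) (c : R) (y y' : nat -> R) (N : nat) : R :=
  ratio_or c
    (emp_mean N (fun i => y i * y' i) - emp_mean N y * emp_mean N y')
    (emp_mean N (fun i => y i ^+ 2) - emp_mean N y ^+ 2).

Definition sobol_T (R : realType) (c : R) (y y' : nat -> R) (N : nat) : R :=
  ratio_or c
    (emp_mean N (fun i => y i * y' i)
       - emp_mean N (fun i => (y i + y' i) / 2) ^+ 2)
    (emp_mean N (fun i => (y i ^+ 2 + y' i ^+ 2) / 2)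
       - emp_mean N (fun i => (y i + y' i) / 2) ^+ 2).

(* Main.v *)
From HB Require Import structures.
Require Import Defs.
From mathcomp Require Import ring lra measurable_realfun.

Set Implicit Arguments.
Unset Strict Implicit.
Unset Printing Implicit Defensive.

Import Order.TTheory GRing.Theory Num.Theory.
Import numFieldNormedType.Exports.

Local Open Scope classical_set_scope.
Local Open Scope ring_scope.

(** Both estimators are continuous functions of empirical means of [Y], [Y^X],
    [Y ^ 2], [(Y^X) ^ 2] and [Y * Y^X], so consistency follows from a strong
    law of large numbers, once the limit has been recognised as the Sobol index.

    Recognising the limit. Let [h x] be the mean of [f (x, Z)] under the law of
    [Z]. By Fubini ([freezing]), [h X] is a version of E(Y|X)
    ([is_cond_exp_partial_mean]), and versions agree almost surely
    ([is_cond_exp_ae_unique]). Freezing the pair [(X, Z)] in [Y * Y^X] gives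
    E(Y Y^X) = E(Y h(X)), and freezing [X] gives E(Y h(X)) = E(h(X)^2). Hence
    Var(E(Y|X)) = E(Y Y^X) - E(Y)^2 ([variance_cond_exp_pick_freeze]). As Y^X has
    the law of Y ([pick_freeze_same_law]), this is also the limit of the two
    numerators, and Var(Y) is the limit of the two denominators.

    The strong law. The summands, such as [Y ^ 2], are only integrable, so the
    law is needed under a first moment alone. The proof ([slln]) is a variant of
    Etemadi's, for pairwise independent, identically distributed variables. It
    is enough to treat nonnegative variables. Along a geometric sequence of
    sizes [k] close to [a = al ^ n], all the [k] summands are truncated at the
    same level [a]; they stay identically distributed, and the Chebyshev
    inequality for the truncated sum together with the union bound for the
    event that some summand exceeds [a] bound the probability of a deviation by
    the mean of [W ^ 2 1_(W <= a) / (eps ^ 2 a) + 2 a 1_(W > a)] ([deviation]),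
    where [W] has the common law. Summed over [n] this is at most a multiple of
    [W] ([sum_deviation_bound]), which is integrable, and the first
    Borel-Cantelli lemma gives convergence along the geometric sequence
    ([subsequence_slln]). Partial sums being monotone, the other sizes lose at
    most a factor [al ^ 2] ([geometric_interpolation]), and [al] is arbitrarily
    close to 1. *)

(** * Laws, independence and integrals *)

Section laws.
Context d (T : measurableType d) (R : realType) (P : probability T R).

Lemma same_law_comp d1 d2 (T1 : measurableType d1) (T2 : measurableType d2)
    (U V : T -> T1) (g : T1 -> T2) : measurable_fun setT g ->
  same_law P U V -> same_law P (g \o U) (g \o V).
Proof.
move=> mg UV A mA; apply: (UV (g @^-1` A)).
by rewrite -[X in measurable X]setTI; exact: mg.
Qed.

Lemma independent2_comp d1 d2 d1' d2' (T1 : measurableType d1)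
    (T2 : measurableType d2) (T1' : measurableType d1')
    (T2' : measurableType d2') (U : T -> T1) (V : T -> T2)
    (g : T1 -> T1') (h : T2 -> T2') :
  measurable_fun setT g -> measurable_fun setT h ->
  independent2 P U V -> independent2 P (g \o U) (h \o V).
Proof.
move=> mg mh UV A B mA mB; apply: (UV (g @^-1` A) (h @^-1` B)).
- by rewrite -[X in measurable X]setTI; exact: mg.
- by rewrite -[X in measurable X]setTI; exact: mh.
Qed.

Lemma independent2_sym d1 d2 (T1 : measurableType d1) (T2 : measurableType d2)
  (U : T -> T1) (V : T -> T2) : independent2 P U V -> independent2 P V U.
Proof. by move=> UV A B mA mB; rewrite setIC muleC UV. Qed.

Section product_law.
Context d1 d2 (T1 : measurableType d1) (T2 : measurableType d2).
Implicit Types (U : {RV P >-> T1}) (V : {RV P >-> T2}).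

(** A probability on a product is determined by its values on rectangles. The
    second factor may be the law of any [V] distributed as [V0], so that two
    pairs with independent components can be compared through one product. *)
Lemma independent2_product_law U V V0 :
  independent2 P U V0 -> same_law P V0 V -> forall A, measurable A ->
  (distribution P U \x distribution P V)%E A
    = P ((fun w => (U w, V0 w)) @^-1` A).
Proof.
move=> UV0 V0V A mA.
have mW : measurable_fun setT (fun w => (U w, V0 w)).
  exact: measurable_fun_pair.
pose W : {RV P >-> (T1 * T2)%type} :=
  HB.pack (fun w => (U w, V0 w)) (isMeasurableFun.Build _ _ _ _ _ mW).
rewrite -[RHS]/(distribution P W A).
apply: product_measure_unique => // B C mB mC.
transitivity (P (U @^-1` B) * P (V0 @^-1` C))%E; first exact: UV0.
by rewrite V0V.
Qed.

Lemma independent2_same_law_pair U V V' :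
  independent2 P U V -> independent2 P U V' -> same_law P V' V ->
  same_law P (fun w => (U w, V' w)) (fun w => (U w, V w)).
Proof.
move=> UV UV' V'V A mA.
rewrite -(independent2_product_law UV' V'V)//.
by rewrite (independent2_product_law (V := V) UV).
Qed.

End product_law.

Section same_law.
Context d1 (T1 : measurableType d1) (U V : T -> T1).
Hypotheses (mU : measurable_fun setT U) (mV : measurable_fun setT V).
Hypothesis UV : same_law P U V.

Lemma same_law_ge0_integral (g : T1 -> \bar R) : measurable_fun setT g ->
  (forall x, 0 <= g x)%E ->
  (\int[P]_w g (U w) = \int[P]_w g (V w))%E.
Proof.
move=> mg g0.
pose U' : {RV P >-> T1} := HB.pack U (isMeasurableFun.Build _ _ _ _ U mU).
pose V' : {RV P >-> T1} := HB.pack V (isMeasurableFun.Build _ _ _ _ V mV).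
rewrite -(ge0_integral_distribution U' mg g0).
rewrite -(ge0_integral_distribution V' mg g0).
by apply: eq_measure_integral => A mA _; exact: UV.
Qed.

Lemma same_law_integrable (g : T1 -> R) : measurable_fun setT g ->
  P.-integrable setT (EFin \o (g \o U)) ->
  P.-integrable setT (EFin \o (g \o V)).
Proof.
move=> mg /integrableP[_ gU]; apply/integrableP; split.
  by apply/measurable_EFinP; exact: measurableT_comp.
move: gU.
rewrite (@same_law_ge0_integral (fun x => `|(g x)%:E|%E)) //.
by apply: measurableT_comp => //; exact/measurable_EFinP.
Qed.

Lemma same_law_integral (g : T1 -> R) : measurable_fun setT g ->
  (\int[P]_w (g (U w))%:E = \int[P]_w (g (V w))%:E)%E.
Proof.
move=> mg; have mEg : measurable_fun setT (EFin \o g) by exact/measurable_EFinP.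
rewrite (integralE _ _ (fun w => (g (U w))%:E)).
rewrite (integralE _ _ (fun w => (g (V w))%:E)).
rewrite (funepos_comp (EFin \o g) U) (funepos_comp (EFin \o g) V).
rewrite (funeneg_comp (EFin \o g) U) (funeneg_comp (EFin \o g) V).
congr (_ - _)%E.
  exact: (same_law_ge0_integral (measurable_funepos mEg) (funepos_ge0 _)).
exact: (same_law_ge0_integral (measurable_funeneg mEg) (funeneg_ge0 _)).
Qed.

End same_law.

End laws.

Section Lfun2.
Context d (T : measurableType d) (R : realType) (P : probability T R).

Lemma integrable_sqr_Lfun2 (f : T -> R) : measurable_fun setT f ->
  P.-integrable setT (EFin \o (fun x => f x ^+ 2)) -> f \in Lfun P 2%:E.
Proof.
move=> mf /integrableP[_ f2].
rewrite inE; apply/andP; split; rewrite inE/=; first exact: mf.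
rewrite /finite_norm unlock /Lnorm poweR_lty//.
apply: le_lt_trans f2; rewrite le_eqVlt; apply/orP; left; apply/eqP.
apply: eq_integral => x _ /=.
by rewrite powR_mulrn ?normr_ge0// normrX.
Qed.

Lemma bounded_integrable (f : T -> R) M : measurable_fun setT f ->
  (forall x, `|f x| <= M) -> P.-integrable setT (EFin \o f).
Proof.
move=> mf fM.
have iM := finite_measure_integrable_cst P M measurableT.
apply: (le_integrable _ _ _ iM) => //.
  exact/measurable_EFinP.
by move=> x _ /=; rewrite lee_fin (le_trans (fM x))// ler_norm.
Qed.

Lemma bounded_Lfun2 (f : T -> R) M : measurable_fun setT f ->
  (forall x, `|f x| <= M) -> f \in Lfun P 2%:E.
Proof.
move=> mf fM; apply: integrable_sqr_Lfun2 => //.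
apply: (@bounded_integrable _ (M ^+ 2)); first exact: measurable_funX.
by move=> x; rewrite normrX ler_sqr ?nnegrE// (le_trans _ (fM x)).
Qed.

Lemma Lfun2_integrable (f : T -> R) : f \in Lfun P 2%:E ->
  P.-integrable setT (EFin \o f).
Proof.
move=> f2; apply/Lfun1_integrable; apply: (Lfun_subset12 _ f2).
exact: fin_num_measure.
Qed.

End Lfun2.

(** * Integrating out an independent variable *)

Section freezing.
Context d (T : measurableType d) (R : realType) (P : probability T R).

(** Unlike [RintegralZl], this holds without integrability: when [g] is not
    integrable and [c] is not 0, both integrals are infinite and [fine] sends
    them to 0. The
    partial integrals below are only almost everywhere integrals of integrable
    functions, so this spares null sets. *)
Lemma measurable_RintegralZl d1 (T1 : measurableType d1) (mu : {measure set T1 -> \bar R})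
    (c : R) (g : T1 -> R) : measurable_fun setT g ->
  \int[mu]_x (c * g x) = c * \int[mu]_x g x.
Proof.
move=> mg.
have [gi|gni] := pselect (mu.-integrable setT (EFin \o g)).
  exact: RintegralZl.
have fine0 (h : T1 -> R) : measurable_fun setT h ->
    ~ mu.-integrable setT (EFin \o h) -> \int[mu]_x h x = 0.
  move=> mh hni; rewrite /Rintegral.
  case: (boolP (\int[mu]_x (h x)%:E \is a fin_num)%E) => [hf|].
    exfalso; apply: hni; apply/integrableP; split; first exact/measurable_EFinP.
    by rewrite integral_fin_num_abs.
  by rewrite fin_numEn => /orP[] /eqP ->.
have [->|c0] := eqVneq c 0.
  rewrite mul0r; under eq_Rintegral do rewrite mul0r.
  by rewrite /Rintegral integral0.
rewrite [in RHS]fine0// mulr0 fine0//; first exact: measurable_funM.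
move=> cgi; apply: gni.
have := integrableZl measurableT c^-1 cgi.
apply: eq_integrable => // x _ /=.
by rewrite -EFinM mulKf.
Qed.

Context d1 d2 (T1 : measurableType d1) (T2 : measurableType d2).
Context (U : {RV P >-> T1}) (V : {RV P >-> T2}).
Hypothesis UV : independent2 P U V.

(** The law of [(U, V)] is the product of the laws, so this is Fubini's theorem
    transported to the probability space. *)
Lemma freezing (g : T1 * T2 -> R) :
    measurable_fun setT g ->
    P.-integrable setT (fun w => (g (U w, V w))%:E) ->
  [/\ measurable_fun setT (fun x => \int[distribution P V]_y g (x, y)),
      P.-integrable setT
        (fun w => (\int[distribution P V]_y g (U w, y))%:E)
    & (\int[P]_w (\int[distribution P V]_y g (U w, y))%:E =
       \int[P]_w (g (U w, V w))%:E)%E].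
Proof.
move=> mg gi.
pose mu := distribution P U; pose nu := distribution P V.
have mW : measurable_fun setT (fun w => (U w, V w)).
  by apply: measurable_fun_pair.
pose W : {RV P >-> (T1 * T2)%type} :=
  HB.pack (fun w => (U w, V w)) (isMeasurableFun.Build _ _ _ _ _ mW).
have prodE A : measurable A -> (mu \x nu)%E A = distribution P W A.
  exact: independent2_product_law.
have mEg : measurable_fun setT (EFin \o g) by exact/measurable_EFinP.
have gint : (mu \x nu)%E.-integrable setT (EFin \o g).
  apply/integrableP; split => //.
  rewrite (eq_measure_integral (distribution P W)); last first.
    by move=> A mA _; exact: prodE.
  rewrite ge0_integral_distribution//; last exact: measurableT_comp.
  by have /integrableP[] := gi.
have mF := measurable_fubini_F gint.
have mH : measurable_fun setT (fun x => \int[nu]_y g (x, y)).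
  exact: (measurableT_comp (@fine_measurable R setT measurableT) mF).
have FH : ae_eq mu setT (fubini_F nu (EFin \o g))
    (fun x => (\int[nu]_y g (x, y))%:E).
  have := ae_integrable1 gint; apply: filterS => x gx _.
  by rewrite /Rintegral fineK//; exact: integrable_fin_num.
have mEH : measurable_fun setT (fun x => (\int[nu]_y g (x, y))%:E).
  exact/measurable_EFinP.
have Hint : mu.-integrable setT (fun x => (\int[nu]_y g (x, y))%:E).
  have /integrableP[_ Fi] := integrable_fubini_F gint.
  apply/integrableP; split => //.
  rewrite -(@ge0_ae_eq_integral _ _ _ mu setT (fun x => `|fubini_F nu (EFin \o g) x|%E)) //.
  - exact: measurableT_comp.
  - exact: measurableT_comp.
  - by apply: filterS FH => x /= /(_ I) ->.
split => //.
  apply/integrableP; split.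
    by apply/measurable_EFinP; exact: (measurableT_comp mH).
  have /integrableP[_] := Hint.
  rewrite ge0_integral_distribution//.
  exact: measurableT_comp.
transitivity (\int[mu]_x (\int[nu]_y g (x, y))%:E)%E.
  rewrite integral_distribution//.
  apply/integrableP; split.
    by apply/measurable_EFinP; exact: (measurableT_comp mH).
  have /integrableP[_] := Hint.
  rewrite ge0_integral_distribution//.
  exact: measurableT_comp.
rewrite -(ae_eq_integral _ _ _ _ _ FH)// integral12_prod_meas1//.
rewrite (eq_measure_integral (distribution P W)); last first.
  by move=> A mA _; exact: prodE.
by rewrite integral_distribution.
Qed.

End freezing.

(** * Sums of pairwise uncorrelated variables *)

Section uncorrelated.
Context d (T : measurableType d) (R : realType) (P : probability T R).

Lemma independent2_expectationM (U V : T -> R) :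
  measurable_fun setT U -> measurable_fun setT V -> independent2 P U V ->
  P.-integrable setT (EFin \o U) -> P.-integrable setT (EFin \o V) ->
  P.-integrable setT (EFin \o (U \* V)) ->
  'E_P[U \* V]%E = ('E_P[U] * 'E_P[V])%E.
Proof.
move=> mU mV UV iU iV iUV.
pose U' : {RV P >-> R} := HB.pack U (isMeasurableFun.Build _ _ _ _ U mU).
pose V' : {RV P >-> R} := HB.pack V (isMeasurableFun.Build _ _ _ _ V mV).
have mg : measurable_fun [set: R * R] (fun p => p.1 * p.2).
  exact: measurable_funM.
have [_ _] := @freezing _ _ _ P _ _ _ _ U' V' UV _ mg iUV.
rewrite unlock => <-; rewrite -(fineK (integrable_fin_num measurableT iV)).
rewrite -integralZr//; apply: eq_integral => w _ /=.
rewrite -EFinM (measurable_RintegralZl _ (U w))//; congr (_ * _)%:E.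
by rewrite /Rintegral integral_distribution.
Qed.

Lemma independent2_covariance0 (U V : T -> R) :
  U \in Lfun P 2%:E -> V \in Lfun P 2%:E -> independent2 P U V ->
  covariance P U V = 0%E.
Proof.
move=> U2 V2 UV.
have iU := Lfun2_integrable U2; have iV := Lfun2_integrable V2.
have iUV : P.-integrable setT (EFin \o (U \* V)).
  exact/Lfun1_integrable/Lfun2_mul_Lfun1.
rewrite covarianceE; [|exact/Lfun1_integrable..].
have mU : measurable_fun setT U by exact/measurable_EFinP/(measurable_int P).
have mV : measurable_fun setT V by exact/measurable_EFinP/(measurable_int P).
rewrite (independent2_expectationM mU mV UV iU iV iUV) subee//.
by rewrite fin_numM// expectation_fin_num//; exact/Lfun1_integrable.
Qed.

(** Pairwise conditions suffice, since only covariances of pairs occur when the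
    square of the sum is expanded. *)
Lemma variance_sum_uncorrelated (Y : nat -> T -> R) n :
  (forall i, Y i \in Lfun P 2%:E) ->
  (forall i j, i != j -> covariance P (Y i) (Y j) = 0%E) ->
  'V_P[(\sum_(i < n) Y i)%R]%E = (\sum_(i < n) 'V_P[Y i])%E.
Proof.
move=> Y2 Y0.
have S2 m : \sum_(i < m) Y i \in Lfun P 2%:E.
  have l12 : (1 <= 2%:E :> \bar R)%E by rewrite lee1n.
  by apply: rpred_sum => i _; exact: Y2.
have cov0 m j : (m <= j)%N -> covariance P (\sum_(i < m) Y i) (Y j) = 0%E.
  elim: m => [_|m IHm mj].
    by rewrite big_ord0; exact: covariance_cst_l.
  rewrite big_ord_recr /= (covarianceDl (S2 m) (Y2 m) (Y2 j)) IHm ?(ltnW mj)// add0e Y0//.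
  by rewrite neq_ltn mj.
elim: n => [|n IHn]; first by rewrite !big_ord0; exact: variance_cst.
by rewrite !big_ord_recr /= (varianceD (S2 n) (Y2 n)) IHn cov0// mule0 adde0.
Qed.

End uncorrelated.

(** * Deviations of sums of truncated variables *)

Lemma sume_const (R : realDomainType) n (x : \bar R) :
  (\sum_(i < n) x = n%:R%:E * x)%E.
Proof.
rewrite mule_natl; elim: n => [|n IHn]; first by rewrite big_ord0.
by rewrite big_ord_recl IHn muleS.
Qed.

Section truncation.
Context (R : realType).

Definition truncation (a x : R) : R := if x <= a then x else 0.

Lemma measurable_truncation a : measurable_fun setT (truncation a).
Proof.
apply: measurable_fun_ifT => //.
by apply: measurable_fun_ler => //; exact: measurable_id.
Qed.

Lemma truncation_ge0 a x : 0 <= x -> 0 <= truncation a x.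
Proof. by rewrite /truncation; case: ifP. Qed.

Lemma truncation_le_id a x : 0 <= x -> truncation a x <= x.
Proof. by rewrite /truncation; case: ifP. Qed.

Lemma truncation_le a x : 0 <= a -> truncation a x <= a.
Proof. by rewrite /truncation; case: ifP. Qed.

End truncation.

Section variance_upper.
Context d (T : measurableType d) (R : realType) (P : probability T R).

Lemma variance_le_second_moment (Y : T -> R) : Y \in Lfun P 2%:E ->
  ('V_P[Y] <= \int[P]_w (Y w ^+ 2)%:E)%E.
Proof.
move=> Y2; rewrite varianceE//.
have -> : (\int[P]_w (Y w ^+ 2)%:E = 'E_P[Y ^+ 2])%E by rewrite unlock.
have /expectation_fin_num E1 : Y \in Lfun P 1.
  by apply/Lfun1_integrable; exact: Lfun2_integrable.
rewrite geeDl// oppe_le0.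
by rewrite -(fineK E1) -EFin_expe lee_fin sqr_ge0.
Qed.

End variance_upper.

Section weak_deviation.
Context d (T : measurableType d) (R : realType) (P : probability T R).
Variables (V : nat -> T -> R) (W : T -> R).
Hypotheses (mV : forall i, measurable_fun setT (V i))
           (mW : measurable_fun setT W).
Hypotheses (V0 : forall i w, 0 <= V i w) (W0 : forall w, 0 <= W w).
Hypothesis indep : forall i j, i != j -> independent2 P (V i) (V j).
Hypothesis law : forall i, same_law P (V i) W.

(** Chebyshev: the truncated summands are bounded, pairwise uncorrelated, and
    identically distributed, so the variance of their sum is at most [k] times
    the second moment of one of them. *)
Lemma truncated_deviation (eps a : R) (k : nat) :
  0 < eps -> 0 < a -> (0 < k)%N ->
  (P [set w | (eps * k%:R <=
       `|\sum_(i < k) truncation a (V i w)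
          - k%:R * \int[P]_w truncation a (W w)|)%R ]
   <= ((eps ^+ 2 * k%:R)^-1)%:E * \int[P]_w (truncation a (W w) ^+ 2)%:E)%E.
Proof.
move=> eps0 a0 k0.
pose Y i := truncation a \o V i.
have mt := @measurable_truncation R a.
have mY i : measurable_fun setT (Y i) by exact: measurableT_comp.
have Ya i w : `|Y i w| <= a.
  by rewrite ger0_norm ?truncation_ge0// truncation_le// ltW.
have Y2 i : Y i \in Lfun P 2%:E by exact: bounded_Lfun2 (mY i) (Ya i).
have Y1 i : P.-integrable setT (EFin \o Y i) by exact: Lfun2_integrable.
have Y0 i j : i != j -> covariance P (Y i) (Y j) = 0%E.
  move=> ij; apply: independent2_covariance0 => //.
  by apply: (independent2_comp mt mt); exact: indep.
have mS : measurable_fun setT (\sum_(i < k) Y i : T -> R)%R.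
  rewrite [X in measurable_fun _ X](_ : _ = fun w => \sum_(i < k) Y i w).
    exact: measurable_sum.
  by apply/funext => w; rewrite fct_sumE.
have kR0 : 0 < k%:R :> R by rewrite ltr0n.
pose S' : {RV P >-> R} := HB.pack (\sum_(i < k) Y i : T -> R)%R
  (isMeasurableFun.Build _ _ _ _ _ mS).
have ES : fine 'E_P[S']%E = k%:R * \int[P]_w truncation a (W w).
  rewrite unlock /=; under eq_integral do rewrite fct_sumE -sumEFin.
  rewrite integral_sum//; last by move=> i; exact: Y1.
  rewrite (eq_bigr (fun=> \int[P]_w (truncation a (W w))%:E)%E); last first.
    by move=> i _; exact: (same_law_integral (mV i) mW (law i) mt).
  rewrite sume_const fineM//.
  apply: integrable_fin_num => //.
  exact: (same_law_integrable (mV 0) mW (law 0) mt (Y1 0)).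
have := @chebyshev _ _ _ P S' (eps * k%:R) (mulr_gt0 eps0 kR0).
rewrite ES (_ : [set _ | _] = [set w | eps * k%:R <=
       `|\sum_(i < k) truncation a (V i w)
          - k%:R * \int[P]_w truncation a (W w)| ]); last first.
  by apply/seteqP; split => w /=; rewrite fct_sumE.
move=> /le_trans; apply.
rewrite (variance_sum_uncorrelated _ Y2 Y0).
set M := (\int[P]_w _)%E.
have M0 : (0 <= M)%E by apply: integral_ge0 => w _; rewrite lee_fin sqr_ge0.
apply: (@le_trans _ _ (((eps * k%:R) ^- 2)%:E * (k%:R%:E * M))%E).
  apply: lee_wpmul2l; first by rewrite lee_fin invr_ge0 sqr_ge0.
  apply: (@le_trans _ _ (\sum_(i < k) M)%E).
    apply: lee_sum => i _; apply: le_trans (variance_le_second_moment (Y2 i)) _.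
    rewrite (same_law_integral (mV i) mW (law i) (g := fun x => truncation a x ^+ 2))//.
    exact: measurable_funX.
  by rewrite sume_const.
rewrite muleA -EFinM.
rewrite (_ : (eps * k%:R) ^- 2 * k%:R = (eps ^+ 2 * k%:R)^-1)//.
by field; rewrite !gt_eqF.
Qed.

(** The mean of [deviation_bound eps a W] is a Chebyshev term plus [2 a P(W > a)],
    which is the union bound over at most [2 a] summands. *)
Definition deviation_bound (eps a x : R) : R :=
  (eps ^+ 2 * a)^-1 * truncation a x ^+ 2 + 2 * a * (if x <= a then 0 else 1).

Lemma measurable_deviation_bound eps a :
  measurable_fun setT (deviation_bound eps a).
Proof.
apply: measurable_funD; apply: measurable_funM => //.
  by apply: measurable_funX; exact: measurable_truncation.
apply: measurable_fun_ifT => //.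
by apply: measurable_fun_ler => //; exact: measurable_id.
Qed.

Lemma deviation_bound_ge0 eps a x : 0 <= a -> 0 <= deviation_bound eps a x.
Proof.
move=> a0; rewrite /deviation_bound addr_ge0//.
  by rewrite mulr_ge0 ?sqr_ge0// invr_ge0 mulr_ge0// sqr_ge0.
by case: ifP => _; rewrite mulr_ge0// mulr_ge0.
Qed.

(** Outside the event that some summand exceeds [a], the truncated sum and the
    sum coincide. *)
Lemma deviation (eps a : R) (k : nat) :
  0 < eps -> 0 < a -> a <= k%:R -> k%:R <= 2 * a ->
  (P [set w | (eps * k%:R <=
       `|\sum_(i < k) V i w - k%:R * \int[P]_w truncation a (W w)|)%R ]
   <= \int[P]_w (deviation_bound eps a (W w))%:E)%E.
Proof.
move=> eps0 a0 ak ka.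
have kR0 : 0 < k%:R :> R by exact: lt_le_trans ak.
have mt := @measurable_truncation R a.
set m := (\int[P]_w _)%R.
set A := [set w | _].
pose B := [set w | eps * k%:R <= `|\sum_(i < k) truncation a (V i w) - k%:R * m| ].
pose C i := [set w | a < V i w].
have mlarge (U : T -> R) : measurable_fun setT U -> measurable [set w | a < U w].
  move=> mU; rewrite (_ : [set w | _] = U @^-1` `]a, +oo[%classic); last first.
    by apply/seteqP; split => w /=; rewrite in_itv/= andbT.
  by rewrite -[X in measurable X]setTI; exact: mU.
have mC i : measurable (C i) by exact: mlarge.
have mD (U : nat -> T -> R) : (forall i, measurable_fun setT (U i)) ->
    measurable [set w | eps * k%:R <= `|\sum_(i < k) U i w - k%:R * m| ].
  move=> mU; rewrite -[X in measurable X]setTI; apply: measurable_fun_le => //.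
  apply: measurableT_comp => //; apply: measurable_funB => //.
  exact: measurable_sum.
have mA : measurable A by exact: mD.
have mB : measurable B.
  by apply: (mD (fun i => truncation a \o V i)) => i; exact: measurableT_comp.
have mbC : measurable (\big[setU/set0]_(i < k) C i) by exact: bigsetU_measurable.
have ABC : A `<=` B `|` \big[setU/set0]_(i < k) C i.
  move=> w Aw; have [Cw|nCw] := pselect ((\big[setU/set0]_(i < k) C i) w).
    by right.
  left; rewrite /B /=.
  rewrite (eq_bigr (fun i : 'I_k => V i w))// => i _.
  rewrite /truncation; case: leP => // aV; exfalso; apply: nCw.
  by rewrite -bigcup_mkord; exists i => //=.
apply: (@le_trans _ _ (P B + P (\big[setU/set0]_(i < k) C i))%E).
  apply: le_trans (measureU2 _ mB mbC).
  by apply: le_measure; rewrite ?inE//; exact: measurableU.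
have -> : (\int[P]_w (deviation_bound eps a (W w))%:E =
    ((eps ^+ 2 * a)^-1)%:E * \int[P]_w (truncation a (W w) ^+ 2)%:E +
    (2 * a)%:E * P [set w | (a < W w)%R])%E.
  have mt2 : measurable_fun setT (fun w => (truncation a (W w) ^+ 2)%:E).
    by apply/measurable_EFinP/measurable_funX; exact: measurableT_comp.
  have c0 : 0 <= (eps ^+ 2 * a)^-1 by rewrite invr_ge0 mulr_ge0 ?sqr_ge0// ltW.
  have a20 : 0 <= 2 * a by rewrite mulr_ge0// ltW.
  have mlW := mlarge _ mW.
  have mi : measurable_fun setT (fun w => (\1_[set w | a < W w] w : R)%:E).
    exact/measurable_EFinP/measurable_indic.
  rewrite -ge0_integralZl_EFin//; last first.
    by move=> w _; rewrite lee_fin sqr_ge0.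
  rewrite -[X in P X]setIT -integral_indic// -ge0_integralZl_EFin//.
  rewrite -ge0_integralD//; last 4 first.
  - by move=> w _; rewrite mule_ge0// lee_fin ?sqr_ge0.
  - exact: measurable_funeM.
  - by move=> w _; rewrite mule_ge0// lee_fin.
  - exact: measurable_funeM.
  apply: eq_integral => w _.
  rewrite -!EFinM -EFinD /deviation_bound indicE; congr (_ + _ * _)%:E.
  by case: leP => aW; [rewrite memNset//= ltNge aW|rewrite mem_set].
apply: leeD.
  apply: le_trans (truncated_deviation eps0 a0 _) _; first by rewrite -(ltr0n R).
  apply: lee_wpmul2r; first by apply: integral_ge0 => w _; rewrite lee_fin sqr_ge0.
  by rewrite lee_fin lef_pV2 ?posrE ?mulr_gt0// ?exprn_gt0// ler_pM2l// exprn_gt0.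
apply: (@le_trans _ _ (\sum_(i < k) P (C i))%E).
  by apply: Boole_inequality => i _; exact: mC.
rewrite (eq_bigr (fun=> P [set w | a < W w])); last first.
  move=> i _; have := @law i `]a, +oo[%classic (measurable_itv _).
  rewrite (_ : V i @^-1` _ = C i); last first.
    by apply/seteqP; split => w /=; rewrite in_itv/= andbT.
  move=> ->; congr (P _).
  by apply/seteqP; split => w /=; rewrite in_itv/= andbT.
rewrite sume_const; apply: lee_wpmul2r => //.
Qed.

End weak_deviation.

(** * Convergence along a geometric sequence of sizes *)

Section geometric_sums.
Context (R : realType) (al : R).
Hypothesis al1 : 1 < al.

Let al0 : 0 < al. Proof. exact: lt_trans al1. Qed.
Let al10 : 0 < al - 1. Proof. by rewrite subr_gt0. Qed.
Let aln n : 0 < al ^+ n. Proof. exact: exprn_gt0. Qed.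

Lemma near_le_expr x : \forall n \near \oo, x <= al ^+ n.
Proof.
have bernoulli n : n%:R * (al - 1) <= al ^+ n.
  elim: n => [|n IHn]; first by rewrite mul0r expr0.
  have : 1 <= al ^+ n by rewrite exprn_ege1// ltW.
  rewrite exprS -natr1; move: IHn; set u := al ^+ n; set v := n%:R.
  move: al10; nra.
near=> n; apply: le_trans (bernoulli n).
rewrite -ler_pdivrMr//; near: n; exact: nbhs_infty_ger.
Unshelve. all: end_near. Qed.

(** The nonzero terms are those of a geometric series stopped before it reaches
    [x]. *)
Lemma sum_geometric_below N x : 0 <= x ->
  \sum_(n < N) al ^+ n * (if x <= al ^+ n then 0 else 1) <= x * (al / (al - 1)).
Proof.
move=> x0; elim: N => [|N IHN].
  by rewrite big_ord0 mulr_ge0// divr_ge0// ltW.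
rewrite big_ord_recr /=; case: (leP x (al ^+ N)) => xa; first by rewrite mulr0 addr0.
have sumle M : \sum_(n < M) al ^+ n * (if x <= al ^+ n then 0 else 1)
    <= al ^+ M / (al - 1).
  elim: M => [|M IHM]; first by rewrite big_ord0 divr_ge0 ?ltW.
  rewrite big_ord_recr /= exprS.
  apply: le_trans (lerD IHM (_ : _ <= al ^+ M)) _.
    by case: ifP => _; rewrite ?mulr1 ?mulr0// ltW.
  rewrite le_eqVlt; apply/orP; left; apply/eqP.
  by field; rewrite gt_eqF.
rewrite mulr1; apply: le_trans (lerD (sumle N) (lexx _)) _.
rewrite (_ : al ^+ N / (al - 1) + al ^+ N = al ^+ N * (al / (al - 1))); last first.
  by field; rewrite gt_eqF.
by apply: ler_wpM2r; [rewrite divr_ge0 ?ltW|exact: ltW].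
Qed.

(** The terms form a geometric series in [1 / al] that starts once [al ^ n] has
    reached [x]; each is [x ^ 2 / al ^ n]. *)
Lemma sum_geometric_above N x : 0 <= x ->
  \sum_(n < N) (al ^+ n)^-1 * truncation (al ^+ n) x ^+ 2 <= x * (al / (al - 1)).
Proof.
move=> x0.
have c0 : 0 <= x * (al / (al - 1)) by rewrite mulr_ge0// divr_ge0 ?ltW.
(* [D N] is the target minus the tail of the series from [N] on, and so is the
   exact value of the partial sum when [x] is one of the first powers of [al]. *)
pose D n := if x <= al ^+ n then x * (al / (al - 1)) * (1 - x / al ^+ n) else 0.
have xale n : x <= al ^+ n -> 0 <= 1 - x / al ^+ n.
  by move=> xn; rewrite subr_ge0 ler_pdivrMr// mul1r.
suff /le_trans : \sum_(n < N) (al ^+ n)^-1 * truncation (al ^+ n) x ^+ 2 <= D N.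
  apply; rewrite /D; case: ifP => // xN.
  by rewrite ler_piMr// lerBlDr lerDl divr_ge0// ltW.
elim: N => [|N IHN].
  by rewrite big_ord0 /D; case: ifP => // /xale ?; rewrite mulr_ge0.
rewrite big_ord_recr /=; apply: le_trans (lerD IHN (lexx _)) _.
rewrite /D /truncation; case: ifPn => xN.
  have xSN : x <= al ^+ N.+1 by rewrite (le_trans xN)// exprS ler_peMl// ltW.
  rewrite xSN (exprS al N) le_eqVlt; apply/orP; left; apply/eqP.
  by field; rewrite !gt_eqF.
rewrite expr0n mulr0 addr0; case: ifP => // /xale ?; exact: mulr_ge0.
Qed.

Lemma sum_deviation_bound eps N x : 0 < eps -> 0 <= x ->
  \sum_(n < N) deviation_bound eps (al ^+ n) x
    <= (eps ^- 2 + 2) * (al / (al - 1)) * x.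
Proof.
move=> eps0 x0; rewrite big_split /=.
rewrite (eq_bigr (fun n : 'I_N =>
    eps ^- 2 * ((al ^+ n)^-1 * truncation (al ^+ n) x ^+ 2))); last first.
  by move=> n _; rewrite invfM -mulrA.
rewrite [X in _ + X <= _](eq_bigr (fun n : 'I_N =>
    2 * (al ^+ n * (if x <= al ^+ n then 0 else 1)))); last first.
  by move=> n _; rewrite -mulrA.
rewrite -!mulr_sumr.
rewrite (_ : _ * x = eps ^- 2 * (x * (al / (al - 1))) + 2 * (x * (al / (al - 1))));
  last by ring.
apply: lerD.
  by rewrite ler_wpM2l ?sum_geometric_above// invr_ge0 sqr_ge0.
by rewrite ler_wpM2l ?sum_geometric_below.
Qed.

End geometric_sums.

Section subsequence.
Context d (T : measurableType d) (R : realType) (P : probability T R).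
Variables (V : nat -> T -> R) (W : T -> R).
Hypotheses (mV : forall i, measurable_fun setT (V i))
           (mW : measurable_fun setT W).
Hypotheses (V0 : forall i w, 0 <= V i w) (W0 : forall w, 0 <= W w).
Hypothesis indep : forall i j, i != j -> independent2 P (V i) (V j).
Hypothesis law : forall i, same_law P (V i) W.
Hypothesis iW : P.-integrable setT (EFin \o W).
Variables (al : R) (k : nat -> nat).
Hypothesis al1 : 1 < al.
Hypothesis k_ge : forall n, al ^+ n <= (k n)%:R.
Hypothesis k_le : forall n, (k n)%:R <= 2 * al ^+ n.

Lemma cvg_truncated_mean :
  \int[P]_w truncation (al ^+ n) (W w) @[n --> \oo] --> \int[P]_w W w.
Proof.
apply: fine_cvg; rewrite fineK; last exact: integrable_fin_num.
have mt n := @measurable_truncation R (al ^+ n).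
have [] := @dominated_convergence _ _ _ P setT measurableT
  (fun n w => (truncation (al ^+ n) (W w))%:E) (EFin \o W) (EFin \o W).
- by move=> n; apply/measurable_EFinP; exact: measurableT_comp.
- exact/measurable_EFinP.
- apply: aeW => w _; apply: cvg_near_cst.
  apply: filterS (near_le_expr al1 (W w)) => n Wn.
  by rewrite /truncation Wn.
- exact: iW.
- apply: aeW => w n _ /=; rewrite lee_fin ger0_norm.
    exact: truncation_le_id.
  exact: truncation_ge0.
by [].
Qed.

(** First Borel-Cantelli lemma: the deviation probabilities are summable, because
    their sum is at most a multiple of the mean of [W]. *)
Lemma subsequence_deviation (eps : R) : 0 < eps ->
  {ae P, forall w, \forall n \near \oo,
    `|\sum_(i < k n) V i w - (k n)%:R * \int[P]_x truncation (al ^+ n) (W x)|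
      < eps * (k n)%:R}.
Proof.
move=> eps0.
have a0 n : 0 < al ^+ n by rewrite exprn_gt0// (lt_trans _ al1).
pose A n := [set w | eps * (k n)%:R <=
  `|\sum_(i < k n) V i w - (k n)%:R * \int[P]_x truncation (al ^+ n) (W x)| ].
have mA n : measurable (A n).
  rewrite -[X in measurable X]setTI; apply: measurable_fun_le => //.
  apply: measurableT_comp => //; apply: measurable_funB => //.
  exact: measurable_sum.
pose C := (eps ^- 2 + 2) * (al / (al - 1)).
have C0 : 0 <= C.
  rewrite mulr_ge0 ?addr_ge0 ?invr_ge0 ?sqr_ge0// divr_ge0 ?subr_ge0 ?ltW//.
  exact: lt_trans al1.
have mb n : measurable_fun setT (fun w => (deviation_bound eps (al ^+ n) (W w))%:E).
  apply/measurable_EFinP.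
  exact: (measurableT_comp (measurable_deviation_bound eps (al ^+ n))).
have b0 n w : (0 <= (deviation_bound eps (al ^+ n) (W w))%:E)%E.
  by rewrite lee_fin deviation_bound_ge0// ltW.
have PA : (\sum_(n <oo) P (A n) < +oo)%E.
  apply: (@le_lt_trans _ _ (C%:E * \int[P]_w (W w)%:E)%E); last first.
    rewrite -(fineK (integrable_fin_num measurableT iW)) -EFinM.
    exact: ltry.
  apply: lime_le; first by apply: is_cvg_nneseries.
  apply: nearW => N; rewrite big_mkord.
  apply: (@le_trans _ _ (\sum_(n < N)
      \int[P]_w (deviation_bound eps (al ^+ n) (W w))%:E)%E).
    by apply: lee_sum => n _; apply: deviation.
  rewrite -ge0_integral_sum// -ge0_integralZl_EFin//; last 2 first.
  - by move=> w _; rewrite lee_fin.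
  - exact/measurable_EFinP.
  apply: ge0_le_integral => //.
  - by move=> w _; apply: sume_ge0.
  - exact: emeasurable_sum.
  - by apply: measurable_funeM; exact/measurable_EFinP.
  - move=> w _; rewrite sumEFin -EFinM lee_fin.
    exact: sum_deviation_bound.
have := lim_sup_set_cvg0 mA PA => PA0.
exists (lim_sup_set A); split => //.
  by apply: bigcap_measurable => // n _; apply: bigcup_measurable.
move=> w /= nw n _; apply: contrapT => nA; apply: nw.
exists n => // j /= nj; rewrite ltNge; apply/negP => Aj.
by apply: nA; exists j.
Qed.

Lemma subsequence_slln (eps : R) : 0 < eps ->
  {ae P, forall w, \forall n \near \oo,
    `|\sum_(i < k n) V i w - (k n)%:R * \int[P]_x W x| <= eps * (k n)%:R}.
Proof.
move=> eps0; have eps20 : 0 < eps / 2 by rewrite divr_gt0.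
have := subsequence_deviation eps20; apply: filterS => w Sw.
have /cvgrPdist_le /(_ _ eps20) mn := cvg_truncated_mean.
near=> n.
set m := (\int[P]_x W x).
rewrite (_ : _ - _ = (\sum_(i < k n) V i w -
    (k n)%:R * \int[P]_x truncation (al ^+ n) (W x)) -
  (k n)%:R * (m - \int[P]_x truncation (al ^+ n) (W x))); last by ring.
rewrite (le_trans (ler_normB _ _))// [eps]splitr mulrDl; apply: lerD.
  by apply: ltW; near: n.
rewrite normrM ger0_norm// mulrC ler_wpM2r//.
by near: n.
Unshelve. all: end_near. Qed.

End subsequence.

(** * The strong law of large numbers *)

Section interpolation.
Context (R : realType).

Definition geometric_index (al : R) n : nat := (Num.truncn (al ^+ n)).+1.

Lemma geometric_index_ge (al : R) n : al ^+ n <= (geometric_index al n)%:R.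
Proof. by apply: ltW; exact: truncnS_gt. Qed.

Lemma geometric_index_le (al : R) n : 1 < al ->
  (geometric_index al n)%:R <= 2 * al ^+ n.
Proof.
move=> al1; have aln : 1 <= al ^+ n by rewrite exprn_ege1// ltW.
rewrite /geometric_index -natr1 mulrDl mul1r; apply: lerD => //.
by rewrite truncn_le (le_trans _ aln).
Qed.

Lemma near_geometric_indexS (al : R) : 1 < al -> \forall n \near \oo,
  (geometric_index al n.+1)%:R <= al ^+ 2 * (geometric_index al n)%:R.
Proof.
move=> al1; have al10 : 0 < al - 1 by rewrite subr_gt0.
near=> n.
have aln : 1 <= al ^+ n.+1 by rewrite exprn_ege1// ltW.
apply: (@le_trans _ _ (al ^+ n.+1 + 1)).
  by rewrite /geometric_index -natr1 lerD2r truncn_le (le_trans _ aln).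
apply: (@le_trans _ _ (al ^+ 2 * al ^+ n)); last first.
  by rewrite ler_wpM2l ?sqr_ge0// geometric_index_ge.
have an : (al - 1)^-1 <= al ^+ n by near: n; exact: near_le_expr.
have : 1 <= al ^+ n * (al - 1) by rewrite -ler_pdivrMr// mul1r.
rewrite exprS expr2; move: al10; set u := al ^+ n; nra.
Unshelve. all: end_near. Qed.

(** [k] need not be monotone: [n.+1] is the first index after [n0] at which [k]
    exceeds [N]. *)
Lemma between_consecutive (k : nat -> nat) n0 N :
  (k n0 <= N)%N -> (exists n, N < k (n0 + n))%N ->
  exists n, (n0 <= n)%N /\ (k n <= N < k n.+1)%N.
Proof.
move=> kN ex; case: (ex_minnP ex) => -[|n] Nk minn.
  by move: Nk; rewrite addn0 ltnNge kN.
exists (n0 + n)%N; rewrite leq_addr -addnS Nk andbT leqNgt; split => //.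
by apply/negP => /minn; rewrite ltnn.
Qed.

(** If [k n <= N < k n.+1] then [s N] lies between [s (k n)] and [s (k n.+1)],
    while [k n.+1 / k n] is eventually at most [al ^ 2]. *)
Lemma geometric_interpolation (s : nat -> R) (m al eps : R) :
  {homo s : i j / (i <= j)%N >-> i <= j} -> (forall n, 0 <= s n) ->
  0 <= m -> 1 < al -> 0 <= eps ->
  (\forall n \near \oo,
    `|s (geometric_index al n) - (geometric_index al n)%:R * m|
      <= eps * (geometric_index al n)%:R) ->
  \forall N \near \oo,
    N%:R * (m - eps) <= al ^+ 2 * s N /\ s N <= al ^+ 2 * (N%:R * (m + eps)).
Proof.
move=> nds s0 m0 al1 eps0 near_s.
have al0 : 0 < al by rewrite (lt_trans _ al1).
have [n0 _ Hn0] : \forall n \near \oo,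
    `|s (geometric_index al n) - (geometric_index al n)%:R * m|
      <= eps * (geometric_index al n)%:R /\
    (geometric_index al n.+1)%:R <= al ^+ 2 * (geometric_index al n)%:R :> R.
  by near=> n; split; near: n => //; exact: near_geometric_indexS.
near=> N.
have [|| n [n0n /andP[knN NkSn]]] :=
    @between_consecutive (geometric_index al) n0 N.
- by near: N; exact: nbhs_infty_ge.
- have [M _ HM] := near_le_expr al1 N%:R.
  exists M; rewrite -(ltr_nat R).
  apply: le_lt_trans (HM (n0 + M)%N (leq_addl _ _)) _.
  exact: truncnS_gt.
have [sn kS] := Hn0 n n0n.
have [sSn _] := Hn0 n.+1 (leqW n0n).
have s1 := nds _ _ knN; have s2 := nds _ _ (ltnW NkSn).
have kN' : (geometric_index al n)%:R <= N%:R :> R by rewrite ler_nat.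
have Nk' : N%:R <= (geometric_index al n.+1)%:R :> R by rewrite ler_nat ltnW.
move: sn; rewrite ler_norml => /andP[sn _].
move: sSn; rewrite ler_norml => /andP[_ sSn].
split.
  have [me|me] := leP 0 (m - eps); last first.
    apply: (@le_trans _ _ 0); first by rewrite mulr_ge0_le0// ltW.
    by rewrite mulr_ge0 ?sqr_ge0.
  apply: (@le_trans _ _ (al ^+ 2 * (geometric_index al n)%:R * (m - eps))).
    by rewrite ler_wpM2r// (le_trans Nk').
  rewrite -mulrA ler_wpM2l ?sqr_ge0//; apply: le_trans s1.
  by lra.
apply: le_trans s2 _.
apply: (@le_trans _ _ ((geometric_index al n.+1)%:R * (m + eps))); first by lra.
rewrite mulrA ler_wpM2r ?addr_ge0//; apply: le_trans kS _.
by rewrite ler_wpM2l ?sqr_ge0.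
Unshelve. all: end_near. Qed.

End interpolation.

Section slln.
Context d (T : measurableType d) (R : realType) (P : probability T R).

(** The almost sure events for [al = 1 + 1 / j.+1] and deviation [1 / j.+1] are
    countably many, so almost surely all of them hold at once. *)
Lemma slln_ge0 (V : nat -> T -> R) (W : T -> R) :
  (forall i, measurable_fun setT (V i)) -> measurable_fun setT W ->
  (forall i w, 0 <= V i w) -> (forall w, 0 <= W w) ->
  (forall i j, i != j -> independent2 P (V i) (V j)) ->
  (forall i, same_law P (V i) W) ->
  P.-integrable setT (EFin \o W) ->
  {ae P, forall w, emp_mean N (V ^~ w) @[N --> \oo] --> \int[P]_x W x}.
Proof.
move=> mV mW V0 W0 indep law iW.
pose del j : R := j.+1%:R^-1.
have del0 j : 0 < del j by rewrite invr_gt0.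
have al1 j : 1 < 1 + del j by rewrite ltrDl.
have := ae_foralln (fun j => @subsequence_slln _ T R P V W mV mW V0 W0 indep law
  iW _ _ (al1 j) (geometric_index_ge _) (fun n => geometric_index_le n (al1 j))
  _ (del0 j)).
apply: filterS => w Sw.
have m0 : 0 <= \int[P]_x W x by exact: Rintegral_ge0.
set m := (\int[P]_x W x) in Sw m0 *.
apply/cvgrPdist_le => e e0.
(* With [al = 1 + del j] and [eps = del j <= 1] we have [al ^ 2 <= 1 + 3 * del j],
   so the interpolation error is at most [del j * (4 + 3 * m)]. *)
have [j ej] : exists j, del j * (4 + 3 * m) <= e.
  have c0 : 0 < 4 + 3 * m by lra.
  exists (Num.truncn ((4 + 3 * m) / e)).
  rewrite /del ler_pdivrMl ?ltr0n// -ler_pdivrMr// ltW//.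
  exact: truncnS_gt.
have del1 : del j <= 1 by rewrite invf_le1// ler1n.
have nds : {homo (fun N => \sum_(i < N) V i w) : i j / (i <= j)%N >-> i <= j}.
  move=> a b ab; rewrite -(subnKC ab) big_split_ord /=.
  by rewrite lerDl sumr_ge0.
have s_ge0 n : 0 <= \sum_(i < n) V i w by exact: sumr_ge0.
have := geometric_interpolation nds s_ge0 m0 (al1 j) (ltW (del0 j)) (Sw j).
move=> near_s; near=> N.
have N0 : 0 < N%:R :> R by rewrite ltr0n; near: N; exact: nbhs_infty_gt.
have [] : N%:R * (m - del j) <= (1 + del j) ^+ 2 * \sum_(i < N) V i w /\
   \sum_(i < N) V i w <= (1 + del j) ^+ 2 * (N%:R * (m + del j)) by near: N.
rewrite /emp_mean; set s := \sum_(i < N) _ => lo hi.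
have {}lo : m - del j <= (1 + del j) ^+ 2 * (N%:R^-1 * s).
  by rewrite mulrCA ler_pdivlMl// mulrC.
have {}hi : N%:R^-1 * s <= (1 + del j) ^+ 2 * (m + del j).
  by rewrite ler_pdivrMl// mulrCA.
have s0 : 0 <= N%:R^-1 * s by rewrite mulr_ge0 ?invr_ge0 ?sumr_ge0// ltW.
move: lo hi s0; move: (N%:R^-1 * s) => u lo hi u0.
have d0 := del0 j; move: (del j) d0 del1 ej lo hi => dl d0 d1 ej lo hi.
rewrite ler_distlC.
have dd : (1 + dl) ^+ 2 <= 1 + 3 * dl by nra.
have h1 : m - dl <= (1 + 3 * dl) * u by nra.
have h2 : u <= (1 + 3 * dl) * (m + dl) by nra.
apply/andP; split; nra.
Unshelve. all: end_near. Qed.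

(** Positive and negative parts are measurable images of the variables, hence
    again pairwise independent and identically distributed. *)
Theorem slln (V : nat -> T -> R) (W : T -> R) :
  (forall i, measurable_fun setT (V i)) -> measurable_fun setT W ->
  (forall i j, i != j -> independent2 P (V i) (V j)) ->
  (forall i, same_law P (V i) W) ->
  P.-integrable setT (EFin \o W) ->
  {ae P, forall w, emp_mean N (V ^~ w) @[N --> \oo] --> \int[P]_x W x}.
Proof.
move=> mV mW indep law iW.
have mid := @measurable_id _ R setT.
have mpos : measurable_fun setT (@idfun R)^\+ by exact: measurable_funrpos.
have mneg : measurable_fun setT (@idfun R)^\- by exact: measurable_funrneg.
have part (g : R -> R) : measurable_fun setT g -> (forall x, 0 <= g x) ->
    P.-integrable setT (EFin \o (g \o W)) ->
    {ae P, forall w, emp_mean N (fun i => g (V i w)) @[N --> \oo] -->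
                     \int[P]_x g (W x)}.
  move=> mg g0 igW; apply: (@slln_ge0 (fun i => g \o V i) (g \o W)) => //.
  - by move=> i; exact: measurableT_comp.
  - exact: measurableT_comp.
  - by move=> i w; exact: g0.
  - by move=> w; exact: g0.
  - by move=> i j ij; apply: (independent2_comp mg mg); exact: indep.
  - by move=> i; exact: (same_law_comp mg).
have ipos : P.-integrable setT (EFin \o ((@idfun R)^\+ \o W)).
  exact: integrable_funrpos.
have ineg : P.-integrable setT (EFin \o ((@idfun R)^\- \o W)).
  exact: integrable_funrneg.
have := part _ mneg (funrneg_ge0 _) ineg.
have := part _ mpos (funrpos_ge0 _) ipos.
apply: filterS2 => w Sp Sn.
have split_part x : (@idfun R)^\+ x - (@idfun R)^\- x = x.
  by have := congr1 (fun h => h x) (funrposBneg (@idfun R)).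
have -> : \int[P]_x W x =
    (\int[P]_x (@idfun R)^\+ (W x)) - (\int[P]_x (@idfun R)^\- (W x)).
  rewrite -(RintegralB measurableT ipos ineg).
  by congr (fine _); apply: eq_integral => x _ /=; rewrite split_part.
rewrite (_ : (fun N => emp_mean N (V ^~ w)) =
    (fun N => emp_mean N (fun i => (@idfun R)^\+ (V i w))
            - emp_mean N (fun i => (@idfun R)^\- (V i w)))); first exact: cvgB.
apply/funext => N; rewrite /emp_mean -mulrBr -sumrB; congr (_ * _).
by apply: eq_bigr => i _; rewrite split_part.
Qed.

End slln.

(** * Conditional expectation of a function of independent variables *)

Section conditional_mean.
Context d (T : measurableType d) (R : realType) (P : probability T R).

(** Two versions have the same integrals over sigma(X), and both are functions on
    the measurable space [S] defined by sigma(X). The identity from [T] to [S] is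
    measurable, so they are almost everywhere equal for the image of [P] on [S],
    and null sets of [S] are null sets of [T]. *)
Lemma is_cond_exp_ae_unique d1 (T1 : measurableType d1) (X : {RV P >-> T1})
    (Y W1 W2 : T -> R) :
  is_cond_exp P X Y W1 -> is_cond_exp P X Y W2 ->
  ae_eq P setT (EFin \o W1) (EFin \o W2).
Proof.
move=> [m1 i1 e1] [m2 i2 e2].
pose S := g_sigma_algebra_preimageType X.
have mid : measurable_fun setT (idfun : T -> S).
  move=> _ A [B mB <-]; apply: measurableI => //.
  by rewrite setTI; apply: measurable_funPTI.
pose J : {RV P >-> S} := HB.pack (idfun : T -> S)
  (isMeasurableFun.Build _ _ _ _ _ mid).
have mS (W : T -> R) : (forall B, measurable B ->
    g_sigma_algebra_preimage X (W @^-1` B)) ->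
    measurable_fun [set: S] (EFin \o W : S -> \bar R).
  move=> mW; apply/measurable_EFinP => _ B mB; rewrite setTI; exact: mW.
have intS (W : T -> R) : (forall B, measurable B ->
    g_sigma_algebra_preimage X (W @^-1` B)) ->
    P.-integrable setT (EFin \o W) -> forall E : set S, measurable E ->
    (\int[distribution P J]_(w in E) (EFin \o W : S -> \bar R) w
      = \int[P]_(w in E) (W w)%:E)%E.
  move=> mW iW E mE; rewrite integral_pushforward//.
  - exact: mS.
  - by apply: (integrableS measurableT) => //; exact: measurable_funPTI.
have [|||N [mN N0 subN]] := @integral_ae_eq _ S _ (distribution P J) setT
  measurableT (EFin \o W2 : S -> \bar R) (EFin \o W1 : S -> \bar R).
- by apply: integrable_pushforward => //; exact: mS.
- exact: mS.
- move=> E _ mE; rewrite !intS//.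
  by rewrite e1// e2.
exists N; split => //.
by rewrite -[X in measurable X]setTI; exact: (mid measurableT).
Qed.

Lemma ae_eq_variance (W1 W2 : T -> R) :
  measurable_fun setT W1 -> measurable_fun setT W2 ->
  ae_eq P setT (EFin \o W1) (EFin \o W2) -> 'V_P[W1]%E = 'V_P[W2]%E.
Proof.
move=> m1 m2 W12.
have E12 : 'E_P[W1]%E = 'E_P[W2]%E.
  by rewrite unlock; apply: ae_eq_integral => //; exact/measurable_EFinP.
rewrite /variance !covariance.unlock E12 !expectation.unlock.
apply: ae_eq_integral => //; [apply/measurable_EFinP..|].
- by apply: measurable_funM; apply: measurable_funB.
- by apply: measurable_funM; apply: measurable_funB.
- by apply: filterS W12 => w /(_ I) [] W12w _; congr ((_ - _) * (_ - _))%:E.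
Qed.

Context d1 d2 (T1 : measurableType d1) (T2 : measurableType d2).
Context (X : {RV P >-> T1}) (Z : {RV P >-> T2}) (f : T1 * T2 -> R).
Hypothesis mf : measurable_fun setT f.
Hypothesis XZ : independent2 P X Z.

Let Y w := f (X w, Z w).
Hypothesis iY : P.-integrable setT (EFin \o Y).

Let h x := \int[distribution P Z]_z f (x, z).

Lemma measurable_partial_mean : measurable_fun setT h.
Proof. by have [] := freezing XZ mf iY. Qed.

(** This is E(phi(X) Y) = E(phi(X) h(X)). It is used with indicators, to see that
    [h X] is a version of E(Y|X), and with [phi = h], to compute its second
    moment. *)
Lemma partial_mean_weight (phi : T1 -> R) : measurable_fun setT phi ->
  P.-integrable setT (fun w => (phi (X w) * Y w)%:E) ->
  P.-integrable setT (fun w => (phi (X w) * h (X w))%:E) /\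
  (\int[P]_w (phi (X w) * h (X w))%:E = \int[P]_w (phi (X w) * Y w)%:E)%E.
Proof.
move=> mphi iphi.
have mg : measurable_fun setT (fun p : T1 * T2 => phi p.1 * f p).
  by apply: measurable_funM => //; exact: measurableT_comp.
have [_] := freezing XZ mg iphi.
have phiE x : \int[distribution P Z]_z (phi (x, z).1 * f (x, z)) = phi x * h x.
  exact: (measurable_RintegralZl _ (phi x) (measurableT_comp mf _)).
by under eq_fun do rewrite phiE.
Qed.

Lemma is_cond_exp_partial_mean : is_cond_exp P X Y (h \o X).
Proof.
have mh := measurable_partial_mean.
split.
- move=> B mB; exists (h @^-1` B); last by rewrite setTI.
  by rewrite -[X in measurable X]setTI; exact: mh.
- have [] := @partial_mean_weight (cst 1) _ _ => //.
    by under eq_fun do rewrite mul1r.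
  by under eq_fun do rewrite mul1r.
- move=> _ [B mB <-]; rewrite setTI.
  have m1 : measurable_fun setT (\1_B : T1 -> R) by exact: measurable_indic.
  have iphi : P.-integrable setT (fun w => (\1_B (X w) * Y w)%:E).
    apply: le_integrable iY => //.
      apply/measurable_EFinP; apply: measurable_funM.
        exact: measurableT_comp.
      exact/measurable_EFinP/(measurable_int P).
    move=> w _ /=; rewrite lee_fin normrM ler_piMl//.
    by rewrite indicE; case: (_ \in _); rewrite ?normr1 ?normr0.
  have [_ e] := partial_mean_weight m1 iphi.
  have toind (W : T -> R) : (\int[P]_(w in X @^-1` B) (W w)%:E =
      \int[P]_w (\1_B (X w) * W w)%:E)%E.
    rewrite integral_mkcond; apply: eq_integral => w _.
    rewrite /patch indicE (_ : (w \in X @^-1` B) = (X w \in B)); last first.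
      by apply/idP/idP; rewrite !inE.
    by case: (X w \in B); rewrite ?mul1r ?mul0r.
  by rewrite !toind.
Qed.

(** [cond_exp] selects some version; the variance does not depend on which. *)
Lemma variance_cond_exp :
  'V_P[cond_exp P X Y]%E = 'V_P[h \o X]%E.
Proof.
have c : is_cond_exp P X Y (cond_exp P X Y).
  rewrite /cond_exp; case: xgetP => [W -> //|].
  by move=> /(_ (h \o X)) []; exact: is_cond_exp_partial_mean.
apply: ae_eq_variance.
- by have [_ + _] := c; move/(measurable_int P)/measurable_EFinP.
- exact: (measurableT_comp measurable_partial_mean).
- exact: (is_cond_exp_ae_unique c is_cond_exp_partial_mean).
Qed.

End conditional_mean.

(** * The pick-freeze identity *)

Section pick_freeze.
Context d (T : measurableType d) (R : realType) (P : probability T R).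
Context d1 d2 (T1 : measurableType d1) (T2 : measurableType d2).
Context (X : {RV P >-> T1}) (Z Z' : {RV P >-> T2}) (f : T1 * T2 -> R).
Hypothesis mf : measurable_fun setT f.
Hypothesis XZ : independent2 P X Z.
Hypothesis Z'_law : same_law P Z' Z.
Hypothesis Z'_indep : independent2 P Z' (fun w => (X w, Z w)).

Let Y w := f (X w, Z w).
Let Y' w := f (X w, Z' w).

Lemma pick_freeze_same_law : same_law P Y' Y.
Proof.
have XZ' : independent2 P X Z'.
  apply: independent2_sym.
  exact: (independent2_comp (@measurable_id _ T2 setT) measurable_fst Z'_indep).
by apply: (same_law_comp mf); exact: independent2_same_law_pair.
Qed.

Lemma measurable_pick_freeze (U : {RV P >-> T2}) :
  measurable_fun setT (fun w => f (X w, U w)).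
Proof. by apply: (measurableT_comp mf); exact: measurable_fun_pair. Qed.

Hypothesis Y2 : Y \in Lfun P 2%:E.

Lemma pick_freeze_Lfun2 : Y' \in Lfun P 2%:E.
Proof.
have mY := measurable_pick_freeze Z; have mY' := measurable_pick_freeze Z'.
have Y'_Y : same_law P Y Y' by move=> A mA; rewrite pick_freeze_same_law.
apply: integrable_sqr_Lfun2 => //.
apply: (@same_law_integrable _ _ _ P _ _ Y Y' mY mY' Y'_Y (fun x => x ^+ 2)).
  exact: measurable_funX.
exact: Lfun2_integrable_sqr.
Qed.

(** Var(E(Y|X)) = Cov(Y, Y^X), as both have mean E(Y): conditionally on [X], the
    variables Y and Y^X are independent with the same mean h(X). *)
Lemma variance_cond_exp_pick_freeze :
  'V_P[cond_exp P X Y]%E = ('E_P[Y \* Y'] - 'E_P[Y] ^+ 2)%E.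
Proof.
have iY := Lfun2_integrable Y2.
pose h x := \int[distribution P Z]_z f (x, z).
have mh : measurable_fun setT h by exact: (measurable_partial_mean mf XZ iY).
have iYY' : P.-integrable setT (EFin \o (Y \* Y')).
  by apply/Lfun1_integrable/Lfun2_mul_Lfun1 => //; exact: pick_freeze_Lfun2.
have mXZ : measurable_fun setT (fun w => (X w, Z w)).
  exact: measurable_fun_pair.
pose XZ_ : {RV P >-> (T1 * T2)%type} :=
  HB.pack (fun w => (X w, Z w)) (isMeasurableFun.Build _ _ _ _ _ mXZ).
have mg : measurable_fun setT
    (fun p : (T1 * T2) * T2 => f p.1 * f (p.1.1, p.2)).
  apply: measurable_funM; first exact: (measurableT_comp mf).
  apply: (measurableT_comp mf); apply: measurable_fun_pair => //.
  exact: measurableT_comp.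
have HE x z : \int[distribution P Z']_z' (f (x, z) * f (x, z')) = h x * f (x, z).
  rewrite mulrC (measurable_RintegralZl _ (f (x, z)) (measurableT_comp mf _))//.
  congr (_ * _); congr (fine _).
  by apply: eq_measure_integral => A mA _; exact: Z'_law.
have [_ ihY EhY] := @freezing _ _ _ P _ _ _ _ XZ_ Z'
  (independent2_sym Z'_indep) _ mg iYY'.
have {}ihY : P.-integrable setT (fun w => (h (X w) * Y w)%:E).
  by apply: eq_integrable ihY => // w _; congr (_%:E); exact: HE.
have {}EhY : (\int[P]_w (h (X w) * Y w)%:E = \int[P]_w (Y w * Y' w)%:E)%E.
  by rewrite -EhY; apply: eq_integral => w _; congr (_%:E); rewrite -HE.
(* Freezing [X] in [h X * Y] also shows that [h X] is square integrable. *)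
have [ih2 Eh2] := partial_mean_weight mf XZ mh ihY.
have ih : P.-integrable setT (EFin \o (h \o X)).
  by have [] := is_cond_exp_partial_mean mf XZ iY.
have Eh : (\int[P]_w (h (X w))%:E = \int[P]_w (Y w)%:E)%E.
  have [_ _ /(_ setT)] := is_cond_exp_partial_mean mf XZ iY; apply.
  by exists setT => //; rewrite setTI.
have h2 : h \o X \in Lfun P 2%:E.
  apply: integrable_sqr_Lfun2; first exact: measurableT_comp.
  exact: ih2.
rewrite (variance_cond_exp mf XZ iY) varianceE//.
have -> : 'E_P[h \o X]%E = 'E_P[Y]%E by rewrite unlock.
congr (_ - _)%E; rewrite expectation.unlock.
by rewrite -EhY -Eh2.
Qed.

End pick_freeze.

Section sampling.
Context d (T : measurableType d) (R : realType) (P : probability T R).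
Context d' (T' : measurableType d').

Lemma mutually_independent_pairwise (Us : nat -> T -> T') i j :
  mutually_independent P Us -> i != j -> independent2 P (Us i) (Us j).
Proof.
move=> indep ij A B mA mB.
(* Only the sets of indices [i] and [j] matter. *)
pose C n := if n == i then A else B.
have mC n : measurable (C n) by rewrite /C; case: ifP.
have := indep [fset i; j]%fset C mC.
rewrite (_ : \bigcap_(_ in _) _ = Us i @^-1` A `&` Us j @^-1` B); last first.
  apply/seteqP; split => w /=.
    move=> H; have := H i; have := H j; rewrite /C /= !inE !eqxx orbT.
    by rewrite eq_sym (negbTE ij) => /(_ isT) Bw /(_ isT) Aw.
  move=> [Aw Bw] n /=; rewrite !inE /C => /orP[/eqP ->|/eqP ->].
    by rewrite eqxx.
  by rewrite eq_sym (negbTE ij).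
move=> ->.
rewrite big_fsetU1 ?inE//= big_seq_fset1.
by rewrite /C eqxx eq_sym (negbTE ij).
Qed.

Lemma slln_iid_copies (U : T -> T') (Us : nat -> T -> T') (g : T' -> R) :
  measurable_fun setT U -> (forall i, measurable_fun setT (Us i)) ->
  measurable_fun setT g -> iid_copies P U Us ->
  P.-integrable setT (EFin \o (g \o U)) ->
  {ae P, forall w, emp_mean N (fun i => g (Us i w)) @[N --> \oo] -->
                   fine 'E_P[g \o U]%E}.
Proof.
move=> mU mUs mg [indep law] ig.
have := @slln _ _ _ P (fun i => g \o Us i) (g \o U) _ _ _ _ ig.
rewrite expectation.unlock; apply.
- by move=> i; exact: measurableT_comp.
- exact: measurableT_comp.
- move=> i j ij; apply: (independent2_comp mg mg).
  exact: mutually_independent_pairwise.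
- by move=> i; exact: (same_law_comp mg).
Qed.

Lemma cvg_ratio_or (c : R) (num den : nat -> R) (a b : R) :
  b != 0 -> num @ \oo --> a -> den @ \oo --> b ->
  ratio_or c (num N) (den N) @[N --> \oo] --> a / b.
Proof.
move=> b0 numa denb.
have : num N / den N @[N --> \oo] --> a / b by apply: cvgM => //; exact: cvgV.
apply: cvg_trans; apply: near_eq_cvg.
have : \forall N \near \oo, den N != 0.
  exact: (cvgr_neq0 _ denb).
apply: filterS => N dN; by rewrite /ratio_or (negbTE dN).
Qed.

End sampling.

(** * Almost sure convergence of the Sobol index estimators *)

Lemma emp_mean_half (R : realType) N (u v : nat -> R) :
  emp_mean N (fun i => (u i + v i) / 2) = (emp_mean N u + emp_mean N v) / 2.
Proof. by rewrite /emp_mean -mulr_suml big_split mulrA mulrDr. Qed.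

Theorem proposition2p1 (d : measure_display) (T : measurableType d)
  (R : realType) (P : probability T R) (p1 p2 : nat)
  (X : {RV P >-> p1.-tuple R}) (Z Z' : {RV P >-> p2.-tuple R})
  (f : p1.-tuple R * p2.-tuple R -> R)
  (Xs : nat -> {RV P >-> p1.-tuple R})
  (Zs Zs' : nat -> {RV P >-> p2.-tuple R})
  (c : R)
  (Y := fun w => f (X w, Z w))
  (Ys := fun w i => f (Xs i w, Zs i w))
  (YXs := fun w i => f (Xs i w, Zs' i w))
  (mf : measurable_fun setT f)
  (XZ_indep : independent2 P X Z)
  (Z'_law : same_law P Z' Z)
  (Z'_indep : independent2 P Z' (fun w => (X w, Z w)))
  (Y_L2 : Y \in Lfun P 2%:E)
  (Y_var : 'V_P[Y]%E <> 0%E)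
  (sample_iid : iid_copies P (fun w => (X w, Z w, Z' w))
     (fun i w => (Xs i w, Zs i w, Zs' i w))) :
  {ae P, forall w, sobol_S c (Ys w) (YXs w) @ \oo --> sobol_index P X Y} /\
  {ae P, forall w, sobol_T c (Ys w) (YXs w) @ \oo --> sobol_index P X Y}.
Proof.
pose Y' w := f (X w, Z' w).
have Y'2 : Y' \in Lfun P 2%:E.
  exact: (pick_freeze_Lfun2 mf XZ_indep Z'_law Z'_indep).
have Y'_law : same_law P Y' Y.
  exact: (pick_freeze_same_law mf XZ_indep Z'_law Z'_indep).
have mY : measurable_fun setT Y by exact: measurable_pick_freeze.
have mY' : measurable_fun setT Y' by exact: measurable_pick_freeze.
have iYY' : P.-integrable setT (EFin \o (Y \* Y')).
  exact/Lfun1_integrable/Lfun2_mul_Lfun1.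
pose m := fine 'E_P[Y]%E; pose q := fine 'E_P[(fun w => Y w ^+ 2)%R]%E.
pose r := fine 'E_P[Y \* Y']%E.
have Em : fine 'E_P[Y']%E = m.
  rewrite /m !expectation.unlock; congr fine.
  exact: (same_law_integral mY' mY Y'_law (@measurable_id _ R setT)).
have Eq : fine 'E_P[(fun w => Y' w ^+ 2)%R]%E = q.
  rewrite /q !expectation.unlock; congr fine.
  apply: (same_law_integral mY' mY Y'_law (g := fun x => x ^+ 2)).
  exact: measurable_funX.
have EmE : 'E_P[Y]%E = m%:E.
  by rewrite fineK// expectation_fin_num//; exact/Lfun1_integrable/Lfun2_integrable.
have EqE : 'E_P[Y ^+ 2]%E = q%:E.
  rewrite fineK// expectation.unlock integrable_fin_num//.
  exact: Lfun2_integrable_sqr.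
have ErE : 'E_P[Y \* Y']%E = r%:E.
  by rewrite fineK// expectation_fin_num//; exact/Lfun1_integrable.
have varE : 'V_P[Y]%E = (q - m ^+ 2)%:E.
  by rewrite varianceE// EqE EmE -EFin_expe.
have den0 : q - m ^+ 2 != 0 by apply/eqP => q0; apply: Y_var; rewrite varE q0.
have -> : sobol_index P X Y = (r - m ^+ 2) / (q - m ^+ 2).
  rewrite /sobol_index varE.
  rewrite (variance_cond_exp_pick_freeze mf XZ_indep Z'_law Z'_indep Y_L2).
  by rewrite -/Y' ErE EmE -EFin_expe.
have mU (A : {RV P >-> p1.-tuple R}) (B C : {RV P >-> p2.-tuple R}) :
    measurable_fun setT (fun w => (A w, B w, C w)).
  by do 2 (apply: measurable_fun_pair => //).
have mg1 : measurable_fun setT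
    (fun p : p1.-tuple R * p2.-tuple R * p2.-tuple R => f p.1).
  exact: measurableT_comp.
have mg2 : measurable_fun setT
    (fun p : p1.-tuple R * p2.-tuple R * p2.-tuple R => f (p.1.1, p.2)).
  apply: (measurableT_comp mf); apply: measurable_fun_pair => //.
  exact: measurableT_comp.
have lln g mg := slln_iid_copies (g := g) (mU X Z Z')
  (fun i => mU (Xs i) (Zs i) (Zs' i)) mg sample_iid.
have means : {ae P, forall w,
    [/\ emp_mean N (Ys w) @[N --> \oo] --> m,
        emp_mean N (YXs w) @[N --> \oo] --> m,
        emp_mean N (fun i => Ys w i ^+ 2) @[N --> \oo] --> q,
        emp_mean N (fun i => YXs w i ^+ 2) @[N --> \oo] --> q &
        emp_mean N (fun i => Ys w i * YXs w i) @[N --> \oo] --> r]}.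
  have l1 := lln _ mg1 (Lfun2_integrable Y_L2).
  have l2 := lln _ mg2 (Lfun2_integrable Y'2).
  have l3 := lln _ (measurable_funX 2 mg1) (Lfun2_integrable_sqr Y_L2).
  have l4 := lln _ (measurable_funX 2 mg2) (Lfun2_integrable_sqr Y'2).
  have l5 := lln _ (measurable_funM mg1 mg2) iYY'.
  apply: filterS (filterI (filterI l1 l2) (filterI (filterI l3 l4) l5)).
  by move=> w [[l1w +] [[l3w +] l5w]]; rewrite Em Eq.
have half (x : R) : (x + x) / 2 = x by field.
split; apply: filterS means => w [cy cy' cq cq' cr].
- apply: cvg_ratio_or => //; rewrite ?expr2; apply: cvgB => //; exact: cvgM.
- have cm : emp_mean N (fun i => (Ys w i + YXs w i) / 2) @[N --> \oo] --> m.
    under eq_fun do rewrite emp_mean_half.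
    rewrite -[m]half.
    by apply: cvgM; [exact: cvgD|exact: cvg_cst].
  apply: cvg_ratio_or => //; rewrite ?expr2; apply: cvgB => //; try exact: cvgM.
  under eq_fun do rewrite emp_mean_half.
  rewrite -[q]half.
  by apply: cvgM; [exact: cvgD|exact: cvg_cst].
Qed.
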